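(* Consider the uplink of a user-centric cell-free massive MIMO network with $L$ access points, $N$ antennas per access point and $K$ single-antenna users, with the model and notation of the context, and let $\rho_u>0$. Consider the max-min fairness problem $$\underset{\eta_1,\dots,\eta_K}{\text{maximize}}\ \ \min_{k}\ \ \eta_k\,\mathbb{E}\{\mathbf{g}_{kk}^{\mathrm H}\}\left(\sum_{i=1}^K\eta_i\,\mathbb{E}\{\mathbf{g}_{ki}\mathbf{g}_{ki}^{\mathrm H}\}-\eta_k\,\mathbb{E}\{\mathbf{g}_{kk}\}\mathbb{E}\{\mathbf{g}_{kk}^{\mathrm H}\}+\mathbf{F}_k\right)^{-1}\mathbb{E}\{\mathbf{g}_{kk}\}$$ $$\text{subject to}\quad 0\le\eta_k\le\rho_u,\quad k=1,\dots,K.$$ Let $\eta_1^{(0)},\dots,\eta_K^{(0)}>0$ be arbitrary, and for $j=1,2,\dots$ define iteratively $$\widetilde{\eta}_k^{(j)}=\frac{1}{\mathbb{E}\{\mathbf{g}_{kk}^{\mathrm H}\}\left(\mathbf{C}_k^{(j-1)}\right)^{-1}\mathbb{E}\{\mathbf{g}_{kk}\}},\qquad \mathbf{C}_k^{(j-1)}=\sum_{i=1}^K\eta_i^{(j-1)}\mathbb{E}\{\mathbf{g}_{ki}\mathbf{g}_{ki}^{\mathrm H}\}-\eta_k^{(j-1)}\mathbb{E}\{\mathbf{g}_{kk}\}\mathbb{E}\{\mathbf{g}_{kk}^{\mathrm H}\}+\mathbf{F}_k,$$ followed by the scaling $$\eta_k^{(j)}=\frac{\rho_u}{\max_{i}\widetilde{\eta}_i^{(j)}}\,\widetilde{\eta}_k^{(j)},\qquad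 k=1,\dots,K.$$ Then, as $j\to\infty$, $(\eta_1^{(j)},\dots,\eta_K^{(j)})$ converges to the optimal solution of the max-min fairness problem.
   Context: $\mathbf{h}_{il}\sim\mathcal{N}_{\mathbb{C}}(\mathbf{0}_N,\mathbf{R}_{il})$ is the random channel in $\mathbb{C}^N$ from user $i$ to access point (AP) $l$; channels of different (user, AP) pairs are independent. For each user $k$, $\mathcal{M}_k\subset\{1,\dots,L\}$ is the fixed nonempty set of APs serving user $k$, with ordered elements $l_{k1}<\dots<l_{k|\mathcal{M}_k|}$. For $l\in\mathcal{M}_k$, $\mathbf{v}_{kl}\in\mathbb{C}^N$ is a random local receive combiner, an arbitrary function of the channel estimates at AP $l$ (obtained from noisy pilot observations of the channels to AP $l$), with $0<\mathbb{E}\{\|\mathbf{v}_{kl}\|^2\}<\infty$ and finite $\mathbb{E}\{|\mathbf{v}_{kl}^{\mathrm H}\mathbf{h}_{il}|^2\}$ for all $i$. The statistics of the combiners are fixed and do not depend on the optimization variables $\eta_k$ (the uplink data transmit powers). The noise variance is $\sigma^2>0$. Define $$\mathbf{g}_{ki}=[\mathbf{v}_{kl_{k1}}^{\mathrm H}\mathbf{h}_{il_{k1}},\dots,\mathbf{v}_{kl_{k|\mathcal{M}_k|}}^{\mathrm H}\mathbf{h}_{il_{k|\mathcal{M}_k|}}]^{\mathrm T}\in\mathbb{C}^{|\mathcal{M}_k|},$$ $$\mathbf{F}_k=\mathrm{diag}\left(\sigma^2\mathbb{E}\{\|\mathbf{v}_{kl_{k1}}\|^2\},\dots,\sigma^2\mathbb{E}\{\|\mathbf{v}_{kl_{k|\mathcal{M}_k|}}\|^2\}\right).$$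 It is assumed that $\mathbb{E}\{\mathbf{g}_{kk}\}\neq\mathbf{0}$ for every $k$. The objective's $k$-th term is the effective SINR of user $k$ when the central processor uses the SINR-maximizing large-scale fading decoding weights for the given powers. *)

(* Defs.v *)
From HB Require Import structures.
From mathcomp Require Import all_boot all_order all_algebra.
From mathcomp Require Import complex.
From mathcomp Require Import all_classical all_reals all_analysis.

Set Implicit Arguments.
Unset Strict Implicit.
Unset Printing Implicit Defensive.

Import Order.TTheory GRing.Theory Num.Theory.
Import numFieldNormedType.Exports.

Local Open Scope classical_set_scope.
Local Open Scope complex_scope.
Local Open Scope sesquilinear_scope.
Local Open Scope ring_scope.

Section ComplexRandomMatrices.
Context (R : realType) (d : measure_display) (T : measurableType d)
        (P : probability T R).

Definition random_mx m n (X : T -> 'M[R[i]]_(m, n)) : Prop :=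
  forall a b, measurable_fun [set: T] (fun w => complex.Re (X w a b)) /\
              measurable_fun [set: T] (fun w => complex.Im (X w a b)).

Definition sigma_mx m n (X : T -> 'M[R[i]]_(m, n)) : set (set T) :=
  <<s [set A | exists a b (B : set R), measurable B /\
        (A = (fun w => complex.Re (X w a b)) @^-1` B \/
         A = (fun w => complex.Im (X w a b)) @^-1` B)] >>.

Definition mutually_independent (I : finType) (F : I -> set (set T)) : Prop :=
  forall (J : {set I}) (E : I -> set T), (forall a, a \in J -> F a (E a)) ->
    P (\bigcap_(a in [set` J]) E a) = (\prod_(a in J) P (E a))%E.

(* [fine] sends an infinite or undefined integral to 0; it is only meaningful
   for integrable [Z]. *)
Definition Ec (Z : T -> R[i]) : R[i] :=
  fine 'E_P[fun w => complex.Re (Z w)] +i* fine 'E_P[fun w => complex.Im (Z w)].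

Definition Emx m n (X : T -> 'M[R[i]]_(m, n)) : 'M[R[i]]_(m, n) :=
  \matrix_(a, b) Ec (fun w => X w a b).

Definition psd_mx n (A : 'M[R[i]]_n) : Prop :=
  A \is hermsymmx /\ forall a : 'cV[R[i]]_n, 0 <= (a ^t* *m A *m a) 0 0.

(* The library's [normal_prob] is not a point mass at zero deviation, so the
   degenerate law is given separately. *)
Definition centered_normal (X : T -> R) (var : R) : Prop :=
  forall B : set R, measurable B ->
    P (X @^-1` B) =
      if var == 0 then \d_(0 : R) B else normal_prob 0 (Num.sqrt var) B.

(* N_C(0, S), with S possibly singular: every real-linear functional
   Re (a^H x) is centred normal with variance a^H S a / 2.  Letting a range over
   all complex vectors (a and 'i a in particular) encodes circular symmetry. *)
Definition complex_gaussian n (X : T -> 'cV[R[i]]_n) (S : 'M[R[i]]_n) : Prop :=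
  [/\ random_mx X, psd_mx S &
      forall a : 'cV[R[i]]_n,
        centered_normal (fun w => complex.Re ((a ^t* *m X w) 0 0))
                        (complex.Re ((a ^t* *m S *m a) 0 0) / 2)].

Definition sqnorm n (x : 'cV[R[i]]_n) : R := \sum_a ComplexField.Normc.normc (x a 0) ^+ 2.

End ComplexRandomMatrices.

Section CellFree.
Context (R : realType) (d : measure_display) (T : measurableType d)
        (P : probability T R).
(* The number of users is K.+1, so that there is at least one. *)
Context (N L K : nat).

(* Received pilot block at one access point: [h i] is the channel of user i to
   it, the row [phi i] is the (power-scaled) pilot sequence of user i, [Z] is
   the receiver noise. *)
Definition pilot_obs tau (phi : 'I_K.+1 -> 'rV[R[i]]_tau)
    (h : 'I_K.+1 -> T -> 'cV[R[i]]_N) (Z : T -> 'M[R[i]]_(N, tau))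
    (w : T) : 'M[R[i]]_(N, tau) :=
  \sum_i h i w *m phi i + Z w.

Definition channel_noise_sigma tau (h : 'I_K.+1 -> 'I_L -> T -> 'cV[R[i]]_N)
    (Z : 'I_L -> T -> 'M[R[i]]_(N, tau))
    (s : ('I_K.+1 * 'I_L) + 'I_L) : set (set T) :=
  match s with
  | inl il => sigma_mx (h il.1 il.2)
  | inr l => sigma_mx (Z l)
  end.

Context (M : 'I_K.+1 -> {set 'I_L}).
Context (h v : 'I_K.+1 -> 'I_L -> T -> 'cV[R[i]]_N).
Context (sigma2 rho : R).

Definition vh (k i : 'I_K.+1) (l : 'I_L) (w : T) : R[i] :=
  ((v k l w) ^t* *m h i l w) 0 0.

(* [enum_val] lists the elements of [M k] in increasing order. *)
Definition g (k i : 'I_K.+1) (w : T) : 'cV[R[i]]_#|M k| :=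
  \col_j vh k i (enum_val j) w.

Definition Fmx (k : 'I_K.+1) : 'M[R[i]]_#|M k| :=
  diag_mx (\row_j (sigma2 * fine 'E_P[fun w => sqnorm (v k (enum_val j) w)])%:C).

Definition Cmx (k : 'I_K.+1) (eta : 'I_K.+1 -> R) : 'M[R[i]]_#|M k| :=
  \sum_i (eta i)%:C *: Emx P (fun w => g k i w *m (g k i w) ^t*)
  - (eta k)%:C *: (Emx P (g k k) *m Emx P (fun w => (g k k w) ^t*))
  + Fmx k.

(* [Cmx k eta] is Hermitian, so the 1 x 1 product is real and taking its real
   part only changes its type. *)
Definition gain (k : 'I_K.+1) (eta : 'I_K.+1 -> R) : R :=
  complex.Re ((Emx P (fun w => (g k k w) ^t*) *m invmx (Cmx k eta)
               *m Emx P (g k k)) 0 0).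

Definition sinr (k : 'I_K.+1) (eta : 'I_K.+1 -> R) : R := eta k * gain k eta.

Definition min_sinr (eta : 'I_K.+1 -> R) : R :=
  \big[Num.min/sinr ord0 eta]_k sinr k eta.

Definition feasible (eta : 'I_K.+1 -> R) : Prop := forall k, 0 <= eta k <= rho.

Definition maxmin_optimal (eta : 'I_K.+1 -> R) : Prop :=
  feasible eta /\ forall eta', feasible eta' -> min_sinr eta' <= min_sinr eta.

Definition eta_tilde (eta : 'I_K.+1 -> R) (k : 'I_K.+1) : R := 1 / gain k eta.

Definition power_step (eta : 'I_K.+1 -> R) (k : 'I_K.+1) : R :=
  rho / (\big[Num.max/eta_tilde eta ord0]_i eta_tilde eta i) * eta_tilde eta k.

Definition power_iter (eta0 : 'I_K.+1 -> R) (j : nat) : 'I_K.+1 -> R :=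
  iter j power_step eta0.

End CellFree.

(* Main.v *)
Require Import Defs.
From mathcomp Require Import all_boot all_order all_algebra.
From mathcomp Require Import complex ring lra.
From mathcomp Require Import all_classical all_reals all_analysis.
From mathcomp Require Import measurable_realfun.
Import Order.TTheory GRing.Theory Num.Theory.
Import numFieldNormedType.Exports.
Local Open Scope classical_set_scope.
Local Open Scope complex_scope.
Local Open Scope ring_scope.

(* Writing b = E g_kk, the reciprocal gain 1 / (b^H C_k(eta)^-1 b) is the minimum
   of w^H C_k(eta) w over w with b^H w = 1.  Since E g_kk g_kk^H - b b^H is a
   covariance matrix, C_k is affine in eta with positive semidefinite
   coefficients, so the map T : eta |-> (1 / gain_k eta)_k is a minimum of
   nondecreasing affine functions: it is positive, monotone and concave on the
   nonnegative orthant.  Hence eta |-> rho T eta / max T eta contracts a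
   multiplicative distance of Hilbert type on {eta | max eta = rho} by a factor
   1 - c^2 < 1, where c T(rho, ..., rho) <= T 0; all orbits converge to the same
   point x, which satisfies T x = x / t for a constant t.  Its SINRs are all equal
   to t, and no feasible eta can make all SINRs exceed t: scaling x down until it
   touches eta from below contradicts monotonicity and concavity. *)

Set Implicit Arguments.
Unset Strict Implicit.
Unset Printing Implicit Defensive.

(** * Normalized iteration of a concave monotone map *)

Section FiniteExtrema.
Context (R : realType) (K : nat).
Implicit Types x : 'I_K.+1 -> R.

(** The seed is an entry of [x], so it does not affect the maximum; [power_step] takes its maximum
    in the same form. *)
Definition vmax x : R := \big[Num.max/x ord0]_i x i.

Lemma le_vmax x k : x k <= vmax x.
Proof. exact: le_bigmax. Qed.

Lemma vmax_attained x : exists k, vmax x = x k.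
Proof.
rewrite /vmax; elim/big_ind: _ => [|a b [i ->] [j ->]|i _]; last by exists i.
  by exists ord0.
by case: (leP (x i) (x j)); [exists j|exists i].
Qed.

Lemma finite_argmax x : exists k, forall i, x i <= x k.
Proof. by have [k xk] := vmax_attained x; exists k => i; rewrite -xk le_vmax. Qed.

Lemma positive_lower_bound x :
  (forall k, 0 < x k) -> exists2 s, 0 < s & forall k, s <= x k.
Proof.
move=> x0; have [k xk] := finite_argmax (fun i => - x i).
by exists (x k) => // i; have := xk i; rewrite lerN2.
Qed.

End FiniteExtrema.

(** * Normalized vectors and a Hilbert-type distance *)

Section NormalizedIteration.
Context (R : realType) (K : nat) (rho : R).
Context (T : ('I_K.+1 -> R) -> 'I_K.+1 -> R).
Implicit Types x y : 'I_K.+1 -> R.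

Hypothesis rho_gt0 : 0 < rho.
Hypothesis T_gt0 : forall x, (forall k, 0 <= x k) -> forall k, 0 < T x k.
Hypothesis T_mono : forall x y, (forall k, 0 <= x k <= y k) ->
  forall k, T x k <= T y k.
(** Concavity along segments that start at the origin. *)
Hypothesis T_superhomog : forall x a, (forall k, 0 <= x k) -> 0 <= a <= 1 ->
  forall k, a * T x k + (1 - a) * T (fun=> 0) k <= T (fun i => a * x i) k.

Definition normalized_step x k := rho / vmax (T x) * T x k.
Local Notation f := normalized_step.

Definition normalized x := (forall k, 0 < x k <= rho) /\ exists k, x k = rho.

(** For normalized vectors and the best [a] and [b], -log (a b) is Hilbert's projective metric, so
    [q] bounds 1 - exp (- metric). *)
Definition hilbert_close x y q := exists a b,
  [/\ 0 < a <= 1, 0 < b <= 1, 1 - a * b <= q,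
      forall k, a * x k <= y k & forall k, b * y k <= x k].

Lemma vmaxT_gt0 x : (forall k, 0 <= x k) -> 0 < vmax (T x).
Proof. by move=> x0; exact: lt_le_trans (T_gt0 x0 ord0) (le_vmax _ _). Qed.

Lemma step_normalized x : (forall k, 0 <= x k) -> normalized (f x).
Proof.
move=> x0; have m0 := vmaxT_gt0 x0; split=> [k|].
  rewrite /f mulr_gt0 ?divr_gt0 ?T_gt0//=.
  by rewrite mulrAC ler_pdivrMr// ler_pM2l// le_vmax.
have [k mk] := vmax_attained (T x).
by exists k; rewrite /f -mk divfK// gt_eqF.
Qed.

Lemma normalized_ge0 x : normalized x -> forall k, 0 <= x k.
Proof. by move=> [xr _] k; have /andP[/ltW] := xr k. Qed.

(** Compare at an index where [x] attains [rho]. *)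
Lemma le1_of_normalized x y a :
  normalized x -> normalized y -> (forall k, a * x k <= y k) -> a <= 1.
Proof.
move=> [_ [k xk]] [yr _] /(_ k); rewrite xk => le.
have /andP[_ yk] := yr k.
by rewrite -(ler_pM2r rho_gt0) mul1r (le_trans le).
Qed.

(** Starting bound for the contraction: the least entry of one vector divided by [rho] is a valid
    constant, since no entry of the other exceeds [rho]. *)
Lemma hilbert_close_normalized x y :
  normalized x -> normalized y -> hilbert_close x y 1.
Proof.
move=> nx ny.
have lower (z w : 'I_K.+1 -> R) : normalized z -> normalized w ->
    exists2 a, 0 < a <= 1 & forall k, a * z k <= w k.
  move=> nz nw; have [|s s0 sw] := @positive_lower_bound R K w.
    by move=> k; have /andP[] := nw.1 k.
  have h k : s / rho * z k <= w k.
    apply: le_trans (sw k); rewrite mulrAC ler_pdivrMr// ler_pM2l//.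
    by have /andP[] := nz.1 k.
  exists (s / rho) => //; rewrite divr_gt0//=; exact: (le1_of_normalized nz nw h).
have [a a01 axy] := lower _ _ nx ny; have [b b01 byx] := lower _ _ ny nx.
exists a, b; split=> //.
have /andP[a0 _] := a01; have /andP[b0 _] := b01.
by rewrite lerBlDr lerDl mulr_ge0// ltW.
Qed.

(** Here x - y <= (1 - a) x <= rho (1 - a), and 1 - a <= 1 - a b because b <= 1; likewise for y -
    x. *)
Lemma hilbert_close_dist x y q :
  normalized x -> normalized y -> hilbert_close x y q ->
  forall k, `|x k - y k| <= rho * q.
Proof.
move=> [nx _] [ny _] [a [b [/andP[a0 a1] /andP[b0 b1] abq axy byx]]] k.
have /andP[x0 xr] := nx k; have /andP[y0 yr] := ny k.
have := axy k; have := byx k; move=> h1 h2.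
have q0 : 0 <= q by apply: le_trans abq; rewrite subr_ge0; nra.
have qa : 1 - a <= q by apply: le_trans abq; nra.
have qb : 1 - b <= q by apply: le_trans abq; nra.
by rewrite ler_norml; apply/andP; split; nra.
Qed.

(** * Strict contraction of the normalized map *)

Variable c : R.
Hypothesis c01 : 0 < c <= 1.
(** The value at 0, which is the noise contribution in the application, is at least a fixed fraction
    of the largest value on normalized vectors; this makes the contraction strict. *)
Hypothesis cT : forall k, c * T (fun=> rho) k <= T (fun=> 0) k.

(** By monotonicity and concavity T y >= T (a x) >= a T x + (1 - a) T 0, and T 0 >= c T (rho, ...,
    rho) >= c T x. *)
Lemma T_scale_lower x y a : normalized x -> normalized y -> 0 < a <= 1 ->
  (forall k, a * x k <= y k) -> forall k, (a + (1 - a) * c) * T x k <= T y k.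
Proof.
move=> nx ny /andP[a0 a1] axy k; have x0 := normalized_ge0 nx.
have /andP[c0 _] := c01.
have h1 : T (fun i => a * x i) k <= T y k.
  by apply: T_mono => i; rewrite mulr_ge0 ?axy// ltW.
have h2 : T x k <= T (fun=> rho) k.
  by apply: T_mono => i; rewrite x0; have /andP[] := nx.1 i.
apply: le_trans h1; apply: le_trans (T_superhomog (a := a) x0 _ k).
  rewrite mulrDl lerD2l -mulrA ler_wpM2l ?subr_ge0//.
  by apply: le_trans (cT k); rewrite ler_pM2l.
by rewrite ltW.
Qed.

Definition rate := 1 - c ^+ 2.

Lemma rate_ge0 : 0 <= rate.
Proof. by rewrite /rate; case/andP: c01 => *; nra. Qed.

Lemma rate_lt1 : rate < 1.
Proof. by rewrite /rate; case/andP: c01 => *; nra. Qed.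

(* With p = a b, the product (a + (1 - a) c)(b + (1 - b) c) of the improved
   constants is at least 1 - (1 - c^2)(1 - p), because a + b >= 2 p. *)
Lemma hilbert_close_step x y q : normalized x -> normalized y ->
  hilbert_close x y q -> hilbert_close (f x) (f y) (rate * q).
Proof.
move=> nx ny [a [b [a01 b01 abq axy byx]]].
have Txy := T_scale_lower nx ny a01 axy.
have Tyx := T_scale_lower ny nx b01 byx.
have x0 := normalized_ge0 nx; have y0 := normalized_ge0 ny.
have mx0 := vmaxT_gt0 x0; have my0 := vmaxT_gt0 y0.
have nfx := step_normalized x0; have nfy := step_normalized y0.
(* Normalizing multiplies the two constants by reciprocal ratios of maxima, so their product is
   unchanged. *)
have fscale z w e : (forall k, 0 <= z k) -> (forall k, 0 <= w k) ->
    (forall k, e * T z k <= T w k) ->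
    forall k, e * (vmax (T z) / vmax (T w)) * f z k <= f w k.
  move=> z0 w0 le k; have mz0 := vmaxT_gt0 z0; have mw0 := vmaxT_gt0 w0.
  have -> : e * (vmax (T z) / vmax (T w)) * f z k =
      rho / vmax (T w) * (e * T z k).
    by rewrite /f; field; rewrite !gt_eqF.
  by rewrite ler_pM2l ?divr_gt0.
have fxy := fscale x y _ x0 y0 Txy; have fyx := fscale y x _ y0 x0 Tyx.
move: a01 b01 c01 => /andP[a0 a1] /andP[b0 b1] /andP[c0 c1].
have A0 : 0 < a + (1 - a) * c by nra.
have B0 : 0 < b + (1 - b) * c by nra.
eexists; eexists; split; [| | |exact: fxy|exact: fyx].
(* The ratio of maxima may exceed 1; the bound by 1 comes from both images being normalized. *)
- by rewrite (le1_of_normalized nfx nfy fxy) mulr_gt0 ?divr_gt0.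
- by rewrite (le1_of_normalized nfy nfx fyx) mulr_gt0 ?divr_gt0.
- have -> : (a + (1 - a) * c) * (vmax (T x) / vmax (T y)) *
     ((b + (1 - b) * c) * (vmax (T y) / vmax (T x))) =
     (a + (1 - a) * c) * (b + (1 - b) * c).
    by field; rewrite !gt_eqF.
  apply: le_trans (ler_wpM2l rate_ge0 abq); rewrite /rate -subr_ge0.
  have -> : (1 - c ^+ 2) * (1 - a * b) -
      (1 - (a + (1 - a) * c) * (b + (1 - b) * c)) =
      c * (1 - c) * (a * (1 - b) + b * (1 - a)) by ring.
  have ab0 : 0 <= a * (1 - b) + b * (1 - a) by nra.
  by apply: mulr_ge0 => //; nra.
Qed.

Lemma iter_normalized x j : normalized x -> normalized (iter j f x).
Proof.
by move=> nx; elim: j => //= j IH; apply: step_normalized; exact: normalized_ge0.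
Qed.

Lemma hilbert_close_iter x y q j : normalized x -> normalized y ->
  hilbert_close x y q ->
  hilbert_close (iter j f x) (iter j f y) (rate ^+ j * q).
Proof.
move=> nx ny xy; elim: j => [|j IH]; first by rewrite mul1r.
by rewrite exprS -mulrA; apply: hilbert_close_step => //; exact: iter_normalized.
Qed.

Lemma iter_close x y j : normalized x -> normalized y ->
  hilbert_close (iter j f x) (iter j f y) (rate ^+ j).
Proof.
move=> nx ny; rewrite -[rate ^+ j]mulr1; apply: hilbert_close_iter => //.
exact: hilbert_close_normalized.
Qed.

Lemma iter_dist x y j k : normalized x -> normalized y ->
  `|iter j f x k - iter j f y k| <= rho * rate ^+ j.
Proof.
move=> nx ny; apply: hilbert_close_dist; [exact: iter_normalized..|].
exact: iter_close.
Qed.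

(** * Convergence of all orbits to a common fixed point *)

Lemma cvg_rate C : (fun j => C * rate ^+ j) @ \oo --> (0 : R).
Proof.
rewrite -[X in _ --> X](mulr0 C); apply: cvgM; first exact: cvg_cst.
by apply: cvg_expr; rewrite ger0_norm ?rate_ge0// rate_lt1.
Qed.

Lemma cvg_of_rate_bound (u w : R^nat) (l C : R) : u @ \oo --> l ->
  (forall j, `|u j - w j| <= C * rate ^+ j) -> w @ \oo --> l.
Proof.
move=> ul uw; have uw0 : (u \- w) @ \oo --> (0 : R).
  apply/norm_cvg0P; apply: (@squeeze_cvgr _ _ _ _ (fun=> 0)
    (fun j => C * rate ^+ j)); [|exact: cvg_cst|exact: cvg_rate].
  by apply: nearW => j; rewrite normr_ge0 uw.
have -> : w = u \- (u \- w) by apply/funext => j /=; rewrite opprB addrC subrK.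
by have := cvgB ul uw0; rewrite subr0; apply.
Qed.

Lemma normalized_cst : normalized (fun=> rho).
Proof. by split=> [k|]; [rewrite rho_gt0 lexx|exists ord0]. Qed.

Let orbit j := iter j f (fun=> rho).

(** Cauchy property: for m >= j, the m-th iterate is j steps applied to the normalized vector
    reached after m - j steps, so it lies within rho rate^j of the j-th iterate. *)
Lemma orbit_cvg k : cvg ((fun j => orbit j k) @ \oo).
Proof.
apply: cauchy_cvg; apply: cauchy_exP => e e0.
have : \forall j \near \oo, `|0 - rho * rate ^+ j| < e.
  by move/cvgrPdist_lt: (cvg_rate rho); apply.
move=> [j _ jP]; exists (orbit j k); exists j => // m /= jm.
apply: le_lt_trans (jP j (leqnn j)); rewrite /= sub0r normrN.
apply: le_trans (ler_norm _).
rewrite /orbit -(subnKC jm) iterD; apply: iter_dist; first exact: normalized_cst.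
exact/iter_normalized/normalized_cst.
Qed.

Definition fixpoint k : R := lim ((fun j => orbit j k) @ \oo).

(** Both constants relating [orbit j] and [orbit (m + j)] are at least their product, hence at least
    1 - rate^j. This bound does not depend on [m] and survives the limit in [m]. *)
Lemma orbit_fixpoint_le j k : (1 - rate ^+ j) * orbit j k <= fixpoint k /\
  (1 - rate ^+ j) * fixpoint k <= orbit j k.
Proof.
have n1 := normalized_cst.
have close m : (1 - rate ^+ j) * orbit j k <= orbit (m + j) k /\
    (1 - rate ^+ j) * orbit (m + j) k <= orbit j k.
  have nm := iter_normalized m n1.
  have [a [b [/andP[a0 a1] /andP[b0 b1] abq axy byx]]] := iter_close j n1 nm.
  have o0 i : 0 <= orbit i k by apply/normalized_ge0/iter_normalized.
  rewrite addnC /orbit iterD; split.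
    by apply: le_trans (axy k); rewrite ler_wpM2r ?o0//; nra.
  apply: le_trans (byx k); rewrite ler_wpM2r//; last by nra.
  by have := o0 (j + m)%N; rewrite /orbit iterD.
have shift : (fun m => orbit (m + j) k) @ \oo --> fixpoint k.
  by rewrite (cvg_shiftn j (fun m => orbit m k)); exact: orbit_cvg.
split; first by apply: (cvgr_to_ge shift); apply: nearW => m; case: (close m).
have h : (fun m => (1 - rate ^+ j) * orbit (m + j) k) @ \oo -->
    (1 - rate ^+ j) * fixpoint k by apply: cvgM => //; exact: cvg_cst.
by apply: (cvgr_to_le h); apply: nearW => m; case: (close m).
Qed.

(** The factor 2 comes from 1 - (1 - p)^2 <= 2 p. The index is a successor because at exponent 0 the
    constant 1 - p would vanish. *)
Lemma orbit_fixpoint_close j :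
  hilbert_close (orbit j.+1) fixpoint (2 * rate ^+ j.+1).
Proof.
have r0 := rate_ge0; have r1 := rate_lt1.
have p0 : 0 <= rate ^+ j.+1 by rewrite exprn_ge0.
have p1 : rate ^+ j.+1 < 1 by rewrite exprn_ilt1.
exists (1 - rate ^+ j.+1), (1 - rate ^+ j.+1); split.
- by rewrite subr_gt0 p1 gerBl.
- by rewrite subr_gt0 p1 gerBl.
- by nra.
- by move=> k; case: (orbit_fixpoint_le j.+1 k).
- by move=> k; case: (orbit_fixpoint_le j.+1 k).
Qed.

Lemma fixpoint_normalized : normalized fixpoint.
Proof.
have n j : normalized (orbit j) by apply: iter_normalized; exact: normalized_cst.
have fr k : 0 < fixpoint k <= rho.
  apply/andP; split.
    (* Index 1 is the first at which 1 - rate^j is positive. *)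
    have [/(lt_le_trans _)-> //] := orbit_fixpoint_le 1 k.
    by rewrite expr1 mulr_gt0 ?subr_gt0 ?rate_lt1//; have /andP[] := (n 1%N).1 k.
  apply: (cvgr_to_le (@orbit_cvg k)); apply: nearW => j.
  by have /andP[] := (n j).1 k.
split=> //; have [k fk] := vmax_attained fixpoint; exists k.
apply/eqP; rewrite eq_le; have /andP[_ ->] /= := fr k.
(* The index where [orbit j] attains [rho] may vary with [j], so (1 - rate^j) rho is compared with
   the maximum of [fixpoint]. *)
have h : (fun j => (1 - rate ^+ j) * rho) @ \oo --> rho.
  under eq_fun do rewrite mulrBl mul1r [_ * rho]mulrC.
  by have := cvgB (cvg_cst rho) (cvg_rate rho); rewrite subr0; apply.
apply: (cvgr_to_le h); apply: nearW => j.
have [_ [i oi]] := n j; rewrite -oi -fk.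
by apply: le_trans (le_vmax _ i); case: (orbit_fixpoint_le j i).
Qed.

(** The contraction takes the place of continuity: [orbit j.+2] and the image of [fixpoint] are one
    contraction step beyond two vectors at distance at most 2 rate^(j+1). *)
Lemma fixpoint_fixed k : f fixpoint k = fixpoint k.
Proof.
have nf := fixpoint_normalized; have nff := step_normalized (normalized_ge0 nf).
have n j : normalized (orbit j) by apply: iter_normalized; exact: normalized_cst.
have lim1 : (fun j => orbit j.+2 k) @ \oo --> fixpoint k.
  rewrite (cvg_shiftS (fun j => orbit j.+1 k)) (cvg_shiftS (orbit ^~ k)).
  exact: orbit_cvg.
have lim2 : (fun j => f fixpoint k) @ \oo --> fixpoint k.
  apply: (cvg_of_rate_bound (C := rho * (rate * (2 * rate))) lim1) => j.
  have := hilbert_close_step (n j.+1) nf (orbit_fixpoint_close j).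
  move=> /(hilbert_close_dist (n j.+2) nff) /(_ k) /le_trans; apply.
  by rewrite exprS !mulrA.
exact: (cvg_unique _ (cvg_cst _) lim2).
Qed.

(** One step normalizes any nonnegative vector; from there the orbit is compared with the reference
    orbit, which explains the shift by one. *)
Lemma normalized_iter_cvg x k : (forall k, 0 <= x k) ->
  (fun j => iter j f x k) @ \oo --> fixpoint k.
Proof.
move=> x0; rewrite -(cvg_shiftS (fun j => iter j f x k)).
apply: (cvg_of_rate_bound (C := rho) (@orbit_cvg k)) => j.
rewrite -[X in _ - X]/(iter j.+1 f x k) iterSr.
apply: iter_dist; first exact: normalized_cst.
exact: step_normalized.
Qed.

(** * Max-min optimality of the fixed point *)

Lemma fixpoint_ratio k : fixpoint k / T fixpoint k = rho / vmax (T fixpoint).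
Proof.
have nf := normalized_ge0 fixpoint_normalized.
by rewrite -{1}fixpoint_fixed /f mulfK// gt_eqF// T_gt0.
Qed.

(** If every ratio exceeded t, let [a] be the least x k / fixpoint k, attained at [k0]. Then T x >=
    T (a fixpoint) >= a T fixpoint, so at [k0] t T x >= a fixpoint = x, a contradiction. *)
Lemma fixpoint_maxmin x : (forall k, 0 <= x k <= rho) ->
  exists k, x k / T x k <= rho / vmax (T fixpoint).
Proof.
move=> xr; have x0 k : 0 <= x k by have /andP[] := xr k.
have nf := normalized_ge0 fixpoint_normalized.
set t := rho / _; have t0 : 0 < t by rewrite divr_gt0 ?vmaxT_gt0.
have fixt k : fixpoint k = t * T fixpoint k by rewrite -fixpoint_fixed.
case: (pselect (exists k, x k / T x k <= t)) => // no_k; exfalso.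
have tx k : t * T x k < x k.
  rewrite -ltr_pdivlMr ?T_gt0// ltNge; apply/negP => le_t.
  by apply: no_k; exists k.
have xp k : 0 < x k by apply: le_lt_trans (tx k); rewrite mulr_ge0// ltW// T_gt0.
have [k0 k0min] := finite_argmax (fun k => - (x k / fixpoint k)).
pose a := x k0 / fixpoint k0.
have [fr [k1 fk1]] := fixpoint_normalized.
have f0 k : 0 < fixpoint k by have /andP[] := fr k.
have ax k : a * fixpoint k <= x k by rewrite -ler_pdivlMr// -lerN2 k0min.
have a0 : 0 < a by rewrite divr_gt0.
(* At [k1] the fixed point equals [rho], which [x] cannot exceed. *)
have a1 : a <= 1.
  rewrite -(ler_pM2r rho_gt0) mul1r -{1}fk1.
  by apply: le_trans (ax k1) _; have /andP[] := xr k1.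
have le1 : a * T fixpoint k0 + (1 - a) * T (fun=> 0) k0 <=
    T (fun i => a * fixpoint i) k0.
  by apply: T_superhomog => //; rewrite ltW.
have le2 : T (fun i => a * fixpoint i) k0 <= T x k0.
  by apply: T_mono => k; rewrite ax mulr_ge0// ltW.
have le3 : a * T fixpoint k0 <= T x k0.
  apply: le_trans le2; apply: le_trans le1.
  by rewrite lerDl mulr_ge0 ?subr_ge0// ltW// T_gt0.
have := tx k0; apply/negP; rewrite -leNgt.
apply: (@le_trans _ _ (t * (a * T fixpoint k0))); last by rewrite ler_pM2l.
by rewrite mulrCA -fixt /a divfK// gt_eqF.
Qed.

End NormalizedIteration.

Lemma normalized_iteration_maxmin (R : realType) (K : nat) (rho : R)
    (T : ('I_K.+1 -> R) -> 'I_K.+1 -> R) :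
  0 < rho ->
  (forall x, (forall k, 0 <= x k) -> forall k, 0 < T x k) ->
  (forall x y, (forall k, 0 <= x k <= y k) -> forall k, T x k <= T y k) ->
  (forall x (a : R), (forall k, 0 <= x k) -> 0 <= a <= 1 ->
    forall k, a * T x k + (1 - a) * T (fun=> 0) k <= T (fun i => a * x i) k) ->
  exists x t, [/\ forall k, 0 <= x k <= rho, forall k, x k / T x k = t,
    forall y, (forall k, 0 <= y k <= rho) -> exists k, y k / T y k <= t &
    forall y, (forall k, 0 <= y k) -> forall k,
      (fun j => iter j (normalized_step rho T) y k) @ \oo --> x k].
Proof.
move=> rho0 T0 Tm Ts.
have r0 (k : 'I_K.+1) : 0 <= rho by rewrite ltW.
have z0 (k : 'I_K.+1) : 0 <= (0 : R) by [].
(* [c] is a positive lower bound of the ratios T 0 / T (rho, ..., rho); monotonicity gives c <=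
   1. *)
have [|c c0 cle] :=
  @positive_lower_bound R K (fun k => T (fun=> 0) k / T (fun=> rho) k).
  by move=> k; rewrite divr_gt0 ?T0.
have cT k : c * T (fun=> rho) k <= T (fun=> 0) k by rewrite -ler_pdivlMr ?T0.
have c01 : 0 < c <= 1.
  rewrite c0 (le_trans (cle ord0))// ler_pdivrMr ?T0// mul1r.
  by apply: Tm => k; rewrite lexx r0.
exists (fixpoint rho T), (rho / vmax (T (fixpoint rho T))); split.
- by move=> k; have /andP[/ltW -> ->] := (fixpoint_normalized rho0 T0 Tm Ts c01 cT).1 k.
- exact: fixpoint_ratio cT.
- exact: fixpoint_maxmin cT.
- by move=> y y0 k; apply: normalized_iter_cvg cT _ _ _.
Qed.

(** * Hermitian forms and minimum-variance gains *)

Section HermitianForms.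
Local Open Scope sesquilinear_scope.
Context (F : numClosedFieldType) (n : nat).
Implicit Types (C : 'M[F]_n) (b w : 'cV[F]_n).

Definition qform C w : F := (w ^t* *m C *m w) 0 0.

Definition posdef C := C ^t* = C /\ forall w, w != 0 -> 0 < qform C w.

Lemma adjmxM m p q (A : 'M[F]_(m, p)) (B : 'M[F]_(p, q)) :
  (A *m B) ^t* = B ^t* *m A ^t*.
Proof. by rewrite trmx_mul map_mxM. Qed.

Lemma adjmxZ p q a (A : 'M[F]_(p, q)) : (a *: A) ^t* = a^* *: A ^t*.
Proof. by apply/matrixP => i j; rewrite !mxE rmorphM. Qed.

Lemma adjmxD p q (A B : 'M[F]_(p, q)) : (A + B) ^t* = A ^t* + B ^t*.
Proof. by apply/matrixP => i j; rewrite !mxE rmorphD. Qed.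

Lemma qformD C D w : qform (C + D) w = qform C w + qform D w.
Proof. by rewrite /qform mulmxDr mulmxDl mxE. Qed.

Lemma qformZ a C w : qform (a *: C) w = a * qform C w.
Proof. by rewrite /qform -scalemxAr -scalemxAl mxE. Qed.

Lemma qform0 w : qform 0 w = 0.
Proof. by rewrite /qform mulmx0 mul0mx mxE. Qed.

Lemma qform_sum (I : finType) (C : I -> 'M[F]_n) w :
  qform (\sum_i C i) w = \sum_i qform (C i) w.
Proof.
by apply: (big_morph (qform^~ w)) => [x y|]; rewrite ?qformD ?qform0.
Qed.

Lemma qform_outer b w : qform (b *m b ^t*) w = `|(b ^t* *m w) 0 0| ^+ 2.
Proof.
rewrite /qform mulmxA -mulmxA mxE big_ord1 normCK mulrC; congr (_ * _).
by rewrite -[in LHS](trmxCK b) -adjmxM !mxE.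
Qed.

(** The adjoint of a nonzero row in the left kernel would have zero form. *)
Lemma posdef_unit C : posdef C -> C \in unitmx.
Proof.
move=> [_ C0]; rewrite -row_free_unit -kermx_eq0; apply/negPn/negP => /eqP k0.
have /existsP[i ki0] : [exists i, row i (kermx C) != 0].
  apply: contraT => /existsPn h; case: k0.
  by apply/row_matrixP => i; rewrite row0; apply/eqP/negPn/h.
have /C0 : (row i (kermx C)) ^t* != 0.
  by apply: contra ki0 => /eqP h; rewrite -[row _ _]trmxCK h trmx0 map_mx0.
by rewrite /qform trmxCK -row_mul mulmx_ker row0 mul0mx mxE ltxx.
Qed.

Variables (C : 'M[F]_n) (b : 'cV[F]_n).
Hypotheses (Cpd : posdef C) (b0 : b != 0).

(** Up to the factor 1 / gn, [u] minimizes w^H C w subject to b^H w = 1: the minimum-variance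
    (Capon) combiner. *)
Let u := invmx C *m b.
Let gn := (b ^t* *m invmx C *m b) 0 0.

Let Cu : C *m u = b.
Proof. by rewrite mulKVmx// posdef_unit. Qed.

Let uC : u ^t* *m C = b ^t*.
Proof. by rewrite -[in LHS](Cpd.1) -adjmxM Cu. Qed.

Let gnE : gn = (b ^t* *m u) 0 0.
Proof. by rewrite /gn mulmxA. Qed.

Lemma inverse_form_gt0 : 0 < gn.
Proof.
have -> : gn = qform C u by rewrite /qform uC gnE.
by apply: Cpd.2; apply: contra b0 => /eqP u0; rewrite -Cu u0 mulmx0.
Qed.

(** Completing the square: the form at w - u / gn equals the form at [w] minus 1 / gn. *)
Lemma inverse_form_le w : (b ^t* *m w) 0 0 = 1 -> gn^-1 <= qform C w.
Proof.
move=> bw; have g0 := inverse_form_gt0.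
have gJ : (gn^-1)^* = gn^-1 by apply/CrealP; rewrite ger0_real// ltW// invr_gt0.
have wb : (w ^t* *m b) 0 0 = 1.
  by rewrite -[b]trmxCK -adjmxM !mxE -[in RHS](conjC1 F) -bw mxE.
have qz : qform C (w - gn^-1 *: u) = qform C w - gn^-1.
  rewrite -scaleNr /qform adjmxD adjmxZ rmorphN /= gJ !scaleNr.
  rewrite mulmxBl -scalemxAl uC mulmxBr !mulmxBl -!scalemxAl -!scalemxAr.
  rewrite -(mulmxA _ C u) Cu.
  move: bw wb gnE; move: (w ^t* *m C *m w) (b ^t* *m w) (w ^t* *m b).
  move: (b ^t* *m u) => V X Y U Y1 U1 V1.
  rewrite !mxE Y1 U1 -V1 mulVf ?gt_eqF// !mulr1; ring.
have [/eqP z0|z0] := boolP (w - gn^-1 *: u == 0).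
  by rewrite -subr_ge0 -qz z0 /qform mulmx0 mxE.
by rewrite -subr_ge0 -qz ltW// Cpd.2.
Qed.

Lemma inverse_form_attained : exists w,
  (b ^t* *m w) 0 0 = 1 /\ qform C w = gn^-1.
Proof.
have g0 := inverse_form_gt0.
have gJ : (gn^-1)^* = gn^-1 by apply/CrealP; rewrite ger0_real// ltW// invr_gt0.
exists (gn^-1 *: u); split.
  by rewrite -scalemxAr mxE -gnE mulVf// gt_eqF.
rewrite /qform adjmxZ gJ -!scalemxAl uC -scalemxAr mxE [X in _ * X]mxE -gnE.
by rewrite mulVf ?mulr1// gt_eqF.
Qed.

End HermitianForms.

(** * The reciprocal gain as a function of the powers *)

Section InterferenceFunction.
Local Open Scope sesquilinear_scope.
Context (R : realType) (m n : nat).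
Context (A : 'I_m -> 'M[R[i]]_n) (B : 'M[R[i]]_n) (b : 'cV[R[i]]_n).
Implicit Types x y : 'I_m -> R.

Hypothesis A_herm : forall i, (A i) ^t* = A i.
Hypothesis A_ge0 : forall i w, 0 <= qform (A i) w.
Hypothesis B_posdef : posdef B.
Hypothesis b_neq0 : b != 0.

Definition affine_mx x := \sum_i (x i)%:C *: A i + B.

(** An interference function in the sense of power control, written to match [eta_tilde]. *)
Definition interference x : R :=
  1 / complex.Re ((b ^t* *m invmx (affine_mx x) *m b) 0 0).

Lemma qform_affine_mx x w :
  qform (affine_mx x) w = \sum_i (x i)%:C * qform (A i) w + qform B w.
Proof.
by rewrite qformD qform_sum; congr (_ + _); apply: eq_bigr => i _; rewrite qformZ.
Qed.

Lemma affine_mx_posdef x : (forall i, 0 <= x i) -> posdef (affine_mx x).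
Proof.
move=> x0; split=> [|w w0].
  rewrite adjmxD B_posdef.1; congr (_ + _).
  rewrite (big_morph (fun M => M ^t*) (@adjmxD _ _ _) (id1 := 0)); last first.
    by rewrite trmx0 map_mx0.
  by apply: eq_bigr => i _; rewrite adjmxZ A_herm [_^*]conjc_real.
rewrite qform_affine_mx ltr_wpDl ?B_posdef.2// sumr_ge0// => i _.
by rewrite mulr_ge0 ?A_ge0// ler0c.
Qed.

(** The inverse form is positive in the order of [R[i]], hence real, so taking its real part loses
    nothing. *)
Lemma interferenceE x : (forall i, 0 <= x i) ->
  (interference x)%:C = ((b ^t* *m invmx (affine_mx x) *m b) 0 0)^-1.
Proof.
move=> x0; have := inverse_form_gt0 (affine_mx_posdef x0) b_neq0.
rewrite /interference; move: (_ 0 0) => z z0.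
by rewrite div1r fmorphV /= RRe_real// ger0_real// ltW.
Qed.

Lemma interference_gt0 x : (forall i, 0 <= x i) -> 0 < interference x.
Proof.
move=> x0; rewrite -ltcR interferenceE// invr_gt0.
by apply: inverse_form_gt0 => //; exact: affine_mx_posdef.
Qed.

Lemma interference_le x w : (forall i, 0 <= x i) -> (b ^t* *m w) 0 0 = 1 ->
  (interference x)%:C <= qform (affine_mx x) w.
Proof.
move=> x0 bw; rewrite interferenceE//.
by apply: inverse_form_le => //; exact: affine_mx_posdef.
Qed.

Lemma interference_attained x : (forall i, 0 <= x i) -> exists w,
  (b ^t* *m w) 0 0 = 1 /\ qform (affine_mx x) w = (interference x)%:C.
Proof.
move=> x0; rewrite interferenceE//.
by apply: inverse_form_attained => //; exact: affine_mx_posdef.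
Qed.

(** The minimizer for [y] is admissible for [x], and its form is nondecreasing in the powers. *)
Lemma interference_mono x y : (forall i, 0 <= x i <= y i) ->
  interference x <= interference y.
Proof.
move=> xy; have x0 i : 0 <= x i by have /andP[] := xy i.
have y0 i : 0 <= y i by have /andP[? /(le_trans _)->] := xy i.
have [w [bw wE]] := interference_attained y0.
rewrite -lecR -wE; apply: le_trans (interference_le x0 bw) _.
rewrite !qform_affine_mx lerD2r; apply: ler_sum => i _.
by rewrite ler_wpM2r// lecR; have /andP[] := xy i.
Qed.

(** At the minimizer for a x the affine form splits into its values at [x] and at 0, each bounded
    below by its own minimum. *)
Lemma interference_superhomog x (a : R) : (forall i, 0 <= x i) -> 0 <= a <= 1 ->
  a * interference x + (1 - a) * interference (fun=> 0) <=
  interference (fun i => a * x i).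
Proof.
move=> x0 /andP[a0 a1].
have ax0 i : 0 <= a * x i by rewrite mulr_ge0.
have [w [bw wE]] := interference_attained ax0.
have split_w : qform (affine_mx (fun i => a * x i)) w =
    a%:C * qform (affine_mx x) w + (1 - a)%:C * qform (affine_mx (fun=> 0)) w.
  rewrite !qform_affine_mx (big1 _ _ (fun i => 0%:C * _)) => [|i _]; last exact: mul0r.
  rewrite add0r mulrDr -addrA -mulrDl -rmorphD /= (addrC a) subrK mul1r mulr_sumr.
  by congr (_ + _); apply: eq_bigr => i _; rewrite rmorphM mulrA.
rewrite -lecR -wE split_w rmorphD (rmorphM _ a) (rmorphM _ (1 - a)) /=.
by apply: lerD; apply: ler_wpM2l; rewrite ?ler0c ?subr_ge0//;
  apply: interference_le.
Qed.

End InterferenceFunction.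

(** * Complex expectations and covariance matrices *)

Section ComplexExpectation.
Local Open Scope sesquilinear_scope.
Context (R : realType) (d : measure_display) (T : measurableType d)
        (P : probability T R).
Implicit Types (X Y : T -> R) (Z W : T -> R[i]).

Lemma Lfun_linear (p : \bar R) (a : R) X Y : (1 <= p)%E ->
  X \in Lfun P p -> Y \in Lfun P p -> (fun w => a * X w + Y w) \in Lfun P p.
Proof. by move=> p1 LX LY; apply: (Lfun_submod_closed P p1).2. Qed.

Lemma eq_Lfun (p : \bar R) X Y : X =1 Y -> X \in Lfun P p -> Y \in Lfun P p.
Proof. by move=> /funext ->. Qed.

Lemma Lfun0 (p : \bar R) : (1 <= p)%E -> (fun=> 0) \in Lfun P p.
Proof. by move=> p1; exact: (Lfun_submod_closed P p1).1. Qed.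

Lemma expectation_linear (a : R) X Y : X \in Lfun P 1 -> Y \in Lfun P 1 ->
  fine 'E_P[fun w => a * X w + Y w] = a * fine 'E_P[X] + fine 'E_P[Y].
Proof.
move=> LX LY.
have LaX : (fun w => a * X w) \in Lfun P 1.
  have := Lfun_linear a (lexx _) LX (Lfun0 (lexx _)).
  by under eq_fun do rewrite addr0.
have -> : (fun w => a * X w + Y w) = (fun w => a * X w) \+ Y by [].
have -> : ('E_P[(fun w => (a * X w)%R) \+ Y] = 'E_P[fun w => (a * X w)%R] + 'E_P[Y])%E.
  exact: expectationD.
have -> : (fun w => a * X w) = a \o* X by apply/funext => w /=; rewrite mulrC.
rewrite expectationZl// fineD ?fineM ?expectation_fin_num//.
by rewrite fin_numM ?expectation_fin_num.
Qed.

Lemma Lfun2_of_sqr X : measurable_fun [set: T] X ->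
  ('E_P[fun w => (X w ^+ 2)%R] < +oo)%E -> X \in Lfun P 2%:E.
Proof.
move=> mX; rewrite unlock => X2.
rewrite inE; apply/andP; split; rewrite inE//=.
rewrite /finite_norm unlock poweR_lty//; apply: le_lt_trans X2.
rewrite le_eqVlt; apply/orP; left; apply/eqP; apply: eq_integral => w _ /=.
by rewrite powR_mulrn// real_normK// num_real.
Qed.

(** Integrability is asked of the real and imaginary parts, the two integrals that make up [Ec]. *)
Definition cLfun (p : \bar R) Z : Prop :=
  (fun w => complex.Re (Z w)) \in Lfun P p /\
  (fun w => complex.Im (Z w)) \in Lfun P p.

Lemma cLfun2_of_normc Z :
  measurable_fun [set: T] (fun w => complex.Re (Z w)) ->
  measurable_fun [set: T] (fun w => complex.Im (Z w)) ->
  ('E_P[fun w => (ComplexField.Normc.normc (Z w) ^+ 2)%R] < +oo)%E ->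
  cLfun 2%:E Z.
Proof.
move=> mR mI Z2.
have nE w : ComplexField.Normc.normc (Z w) ^+ 2 =
    complex.Re (Z w) ^+ 2 + complex.Im (Z w) ^+ 2.
  by case: (Z w) => a b /=; rewrite sqr_sqrtr// addr_ge0 ?sqr_ge0.
have m2 : measurable_fun [set: T] (fun w => ComplexField.Normc.normc (Z w) ^+ 2).
  by under eq_fun do rewrite nE; apply: measurable_funD; exact: measurable_funX.
by split; apply: Lfun2_of_sqr => //; apply: le_lt_trans Z2;
  apply: expectation_le => //; rewrite ?nE;
  try (by apply: measurable_funX); try (by move=> w; exact: sqr_ge0);
  apply: nearW => w; rewrite nE ?lerDl ?lerDr sqr_ge0.
Qed.

Lemma cLfun_linear (p : \bar R) c Z W : (1 <= p)%E ->
  cLfun p Z -> cLfun p W -> cLfun p (fun w => c * Z w + W w).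
Proof.
move=> p1 [ZR ZI] [WR WI]; case: c => a b; split.
- apply: (eq_Lfun _ (Lfun_linear a p1 ZR (Lfun_linear (- b) p1 ZI WR))) => w.
  by case: (Z w) (W w) => z1 z2 [w1 w2] /=; ring.
- apply: (eq_Lfun _ (Lfun_linear a p1 ZI (Lfun_linear b p1 ZR WI))) => w.
  by case: (Z w) (W w) => z1 z2 [w1 w2] /=; ring.
Qed.

Lemma Ec_linear c Z W : cLfun 1 Z -> cLfun 1 W ->
  Ec P (fun w => c * Z w + W w) = c * Ec P Z + Ec P W.
Proof.
move=> [ZR ZI] [WR WI]; case: c => a b; rewrite /Ec.
have -> : (fun w => complex.Re ((a +i* b) * Z w + W w)) = (fun w =>
    a * complex.Re (Z w) + (- b * complex.Im (Z w) + complex.Re (W w))).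
  by apply/funext => w; case: (Z w) (W w) => z1 z2 [w1 w2] /=; ring.
have -> : (fun w => complex.Im ((a +i* b) * Z w + W w)) = (fun w =>
    a * complex.Im (Z w) + (b * complex.Re (Z w) + complex.Im (W w))).
  by apply/funext => w; case: (Z w) (W w) => z1 z2 [w1 w2] /=; ring.
rewrite !expectation_linear ?Lfun_linear//.
by apply/eqP; rewrite eq_complex /=; apply/andP; split; apply/eqP; ring.
Qed.

Lemma cLfun0 (p : \bar R) : (1 <= p)%E -> cLfun p (fun=> 0).
Proof. by move=> p1; split; exact: Lfun0. Qed.

Lemma Ec0 : Ec P (fun=> 0) = 0.
Proof. by rewrite /Ec /= (expectation_cst P 0). Qed.

Lemma cLfun_sum (I : Type) (r : seq I) (p : \bar R) (c : I -> R[i])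
    (Z : I -> T -> R[i]) : (1 <= p)%E -> (forall i, cLfun p (Z i)) ->
  cLfun p (fun w => \sum_(i <- r) c i * Z i w).
Proof.
move=> p1 ZL; elim: r => [|i r IH].
  by under eq_fun do rewrite big_nil; exact: cLfun0.
by under eq_fun do rewrite big_cons; exact: cLfun_linear.
Qed.

Lemma Ec_sum (I : Type) (r : seq I) (c : I -> R[i]) (Z : I -> T -> R[i]) :
  (forall i, cLfun 1 (Z i)) ->
  Ec P (fun w => \sum_(i <- r) c i * Z i w) = \sum_(i <- r) c i * Ec P (Z i).
Proof.
move=> ZL; elim: r => [|i r IH].
  by under eq_fun do rewrite big_nil; rewrite big_nil Ec0.
under eq_fun do rewrite big_cons.
by rewrite big_cons Ec_linear ?IH//; exact: cLfun_sum.
Qed.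

Lemma Ec_conj Z : cLfun 1 Z -> Ec P (fun w => (Z w)^*) = (Ec P Z)^*.
Proof.
move=> [ZR ZI]; rewrite /Ec.
have -> : (fun w => complex.Re ((Z w)^*)) = (fun w => complex.Re (Z w)).
  by apply/funext => w; case: (Z w).
have -> : (fun w => complex.Im ((Z w)^*)) = (fun w => -1 * complex.Im (Z w) + 0).
  by apply/funext => w; case: (Z w) => a b /=; rewrite mulN1r addr0.
rewrite expectation_linear// ?Lfun0// (expectation_cst P 0) /= mulN1r addr0.
by [].
Qed.

Lemma cLfun_conj (p : \bar R) Z : (1 <= p)%E -> cLfun p Z ->
  cLfun p (fun w => (Z w)^*).
Proof.
move=> p1 [ZR ZI]; split.
  by apply: eq_Lfun ZR => w; case: (Z w).
apply: (eq_Lfun _ (Lfun_linear (-1) p1 ZI (Lfun0 p1))) => w.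
by case: (Z w) => a b /=; rewrite mulN1r addr0.
Qed.

Lemma cLfun2_mul Z W : cLfun 2%:E Z -> cLfun 2%:E W -> cLfun 1 (fun w => Z w * W w).
Proof.
move=> [ZR ZI] [WR WI]; split.
- apply: (eq_Lfun _ (Lfun_linear (-1) (lexx _)
    (Lfun2_mul_Lfun1 ZI WI) (Lfun2_mul_Lfun1 ZR WR))) => w.
  rewrite /=; case: (Z w) (W w) => z1 z2 [w1 w2] /=; ring.
- apply: (eq_Lfun _ (Lfun_linear 1 (lexx _)
    (Lfun2_mul_Lfun1 ZI WR) (Lfun2_mul_Lfun1 ZR WI))) => w.
  rewrite /=; case: (Z w) (W w) => z1 z2 [w1 w2] /=; ring.
Qed.

Lemma cLfun2_cLfun1 Z : cLfun 2%:E Z -> cLfun 1 Z.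
Proof.
by case=> ZR ZI; split; apply: (Lfun_subset12 _) => //; exact: fin_num_measure.
Qed.

(** Nonnegativity of the variance. *)
Lemma sqr_expectation_le X : X \in Lfun P 2%:E ->
  fine 'E_P[X] ^+ 2 <= fine 'E_P[fun w => X w * X w].
Proof.
move=> LX; have := variance_ge0 P X; rewrite varianceE//.
have LX1 : X \in Lfun P 1 by apply: (Lfun_subset12 _ LX); exact: fin_num_measure.
have LXX := Lfun2_mul_Lfun1 LX LX.
rewrite -[X in ('E_P[X] - _)%E]/(X \* X).
rewrite -(fineK (expectation_fin_num LXX)) -(fineK (expectation_fin_num LX1)).
by rewrite -EFin_expe -EFinB lee_fin subr_ge0.
Qed.

(** The product of [Z] with its conjugate is real, and the bound is the sum of the variance
    inequalities for the two parts. *)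
Lemma sqr_norm_Ec_le Z : cLfun 2%:E Z ->
  `|Ec P Z| ^+ 2 <= Ec P (fun w => Z w * (Z w)^*).
Proof.
move=> [ZR ZI]; rewrite -add_Re2_Im2 lecE; apply/andP; split.
  rewrite /Ec /=; have -> : (fun w => complex.Im (Z w * (Z w)^*)) = cst 0.
    by apply/funext => w; case: (Z w) => a b /=; ring.
  by rewrite expectation_cst.
have -> : complex.Re (Ec P (fun w => Z w * (Z w)^*)) =
    fine 'E_P[fun w => complex.Re (Z w) * complex.Re (Z w)] +
    fine 'E_P[fun w => complex.Im (Z w) * complex.Im (Z w)].
  rewrite /= -[X in X + _]mul1r -expectation_linear ?Lfun2_mul_Lfun1//.
  congr (fine 'E_P[_]); apply/funext => w.
  by case: (Z w) => a b /=; ring.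
by rewrite lerD// sqr_expectation_le.
Qed.

Definition cLfun_mx p m n (X : T -> 'M[R[i]]_(m, n)) : Prop :=
  forall a b, cLfun p (fun w => X w a b).

Lemma Emx_adj m n (X : T -> 'M[R[i]]_(m, n)) : cLfun_mx 1 X ->
  Emx P (fun w => (X w) ^t*) = (Emx P X) ^t*.
Proof.
move=> XL; apply/matrixP => a b; rewrite !mxE -Ec_conj//.
by congr (Ec P _); apply/funext => w; rewrite !mxE.
Qed.

Lemma cLfun_mulmxl (p : \bar R) m n q (A : 'M[R[i]]_(q, m)) (X : T -> 'M[R[i]]_(m, n)) :
  (1 <= p)%E -> cLfun_mx p X -> cLfun_mx p (fun w => A *m X w).
Proof.
move=> p1 XL a b; under eq_fun do rewrite mxE; exact: cLfun_sum.
Qed.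

Lemma Emx_mull m n q (A : 'M[R[i]]_(q, m)) (X : T -> 'M[R[i]]_(m, n)) :
  cLfun_mx 1 X -> Emx P (fun w => A *m X w) = A *m Emx P X.
Proof.
move=> XL; apply/matrixP => a b; rewrite !mxE.
under eq_fun do rewrite mxE; rewrite Ec_sum//.
by apply: eq_bigr => i _; rewrite mxE.
Qed.

Lemma Emx_mulr m n q (A : 'M[R[i]]_(n, q)) (X : T -> 'M[R[i]]_(m, n)) :
  cLfun_mx 1 X -> Emx P (fun w => X w *m A) = Emx P X *m A.
Proof.
move=> XL; apply/matrixP => a b; rewrite !mxE.
under eq_fun => w do (rewrite mxE; under eq_bigr do rewrite mulrC).
by rewrite Ec_sum//; apply: eq_bigr => i _; rewrite mxE mulrC.
Qed.

Context (n : nat) (X : T -> 'cV[R[i]]_n).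
Hypothesis X2 : cLfun_mx 2%:E X.

Lemma cLfun_outer : cLfun_mx 1 (fun w => X w *m (X w) ^t*).
Proof.
move=> a b; under eq_fun do rewrite mxE big_ord1 !mxE.
by apply: cLfun2_mul; [exact: X2|apply: cLfun_conj; [rewrite lee_fin ler1n|exact: X2]].
Qed.

Lemma Emx_outer_herm :
  (Emx P (fun w => X w *m (X w) ^t*)) ^t* = Emx P (fun w => X w *m (X w) ^t*).
Proof.
rewrite -Emx_adj; last exact: cLfun_outer.
by congr (Emx P _); apply/funext => w; rewrite adjmxM trmxCK.
Qed.

Lemma qform_Emx_outer a :
  qform (Emx P (fun w => X w *m (X w) ^t*)) a =
  Ec P (fun w => (a ^t* *m X w) 0 0 * ((a ^t* *m X w) 0 0)^*).
Proof.
have L := cLfun_outer.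
rewrite /qform -Emx_mull// -Emx_mulr; last exact: cLfun_mulmxl.
rewrite mxE; congr (Ec P _); apply/funext => w.
rewrite mulmxA -mulmxA mxE big_ord1; congr (_ * _).
by rewrite -[in LHS](trmxCK a) -adjmxM !mxE.
Qed.

(** The difference of the two matrices is the covariance of [X]; the scalar inequality is applied to
    a^H X. *)
Lemma qform_Emx_outer_ge a :
  qform (Emx P X *m (Emx P X) ^t*) a <= qform (Emx P (fun w => X w *m (X w) ^t*)) a.
Proof.
have X1 : cLfun_mx 1 X by move=> i j; apply: cLfun2_cLfun1.
rewrite qform_outer qform_Emx_outer -norm_conjC.
have -> : (((Emx P X) ^t* *m a) 0 0)^* = Ec P (fun w => (a ^t* *m X w) 0 0).
  by rewrite -[in LHS](trmxCK a) -adjmxM -Emx_mull// !mxE conjCK.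
apply: sqr_norm_Ec_le.
by apply: cLfun_mulmxl => //; rewrite lee_fin ler1n.
Qed.

Lemma qform_Emx_outer_ge0 a : 0 <= qform (Emx P (fun w => X w *m (X w) ^t*)) a.
Proof.
by apply: le_trans (qform_Emx_outer_ge a); rewrite qform_outer exprn_ge0.
Qed.

End ComplexExpectation.

(** * Measurability of adjoints and products of random matrices *)

Section ComplexMeasurability.
Local Open Scope sesquilinear_scope.
Context (R : realType) (d : measure_display) (T : measurableType d).

Lemma random_mx_adj m n (X : T -> 'M[R[i]]_(m, n)) :
  random_mx X -> random_mx (fun w => (X w) ^t*).
Proof.
move=> mX a b; have [mR mI] := mX b a; split.
  rewrite (_ : (fun w => _) = (fun w => complex.Re (X w b a))) //.
  by apply/funext => w; rewrite !mxE; case: (X w b a).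
rewrite (_ : (fun w => _) = (fun w => - complex.Im (X w b a))).
  exact: measurableT_comp.
by apply/funext => w; rewrite !mxE; case: (X w b a).
Qed.

Lemma random_mx_mul m n p (X : T -> 'M[R[i]]_(m, n)) (Y : T -> 'M[R[i]]_(n, p)) :
  random_mx X -> random_mx Y -> random_mx (fun w => X w *m Y w).
Proof.
move=> mX mY a b.
have ReM (z w : R[i]) : complex.Re (z * w) =
    complex.Re z * complex.Re w - complex.Im z * complex.Im w.
  by case: z w => ? ? [].
have ImM (z w : R[i]) : complex.Im (z * w) =
    complex.Re z * complex.Im w + complex.Im z * complex.Re w.
  by case: z w => ? ? [].
have ReD : {morph @complex.Re R : z w / z + w} by move=> [? ?] [].
have ImD : {morph @complex.Im R : z w / z + w} by move=> [? ?] [].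
split.
  under eq_fun do rewrite mxE (big_morph _ ReD (erefl _)).
  apply: measurable_sum => j; under eq_fun do rewrite ReM.
  by apply: measurable_funB; apply: measurable_funM;
    case: (mX a j) => ? ?; case: (mY j b).
under eq_fun do rewrite mxE (big_morph _ ImD (erefl _)).
apply: measurable_sum => j; under eq_fun do rewrite ImM.
by apply: measurable_funD; apply: measurable_funM;
  case: (mX a j) => ? ?; case: (mY j b).
Qed.

End ComplexMeasurability.

Lemma diag_mx_posdef (R : realType) n (f : 'I_n -> R) :
  (forall j, 0 < f j) -> posdef (diag_mx (\row_j (f j)%:C)).
Proof.
move=> f0; split.
  apply/matrixP => a b; rewrite !mxE.
  by case: (eqVneq a b) => [->|ab]; rewrite ?eqxx ?mulr1n ?[_^*]conjc_real//
    eq_sym (negbTE ab) mulr0n conjC0.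
move=> w w0.
have -> : qform (diag_mx (\row_j (f j)%:C)) w = \sum_j (f j)%:C * `|w j 0| ^+ 2.
  rewrite /qform mxE; apply: eq_bigr => j _.
  rewrite mul_mx_diag !mxE normCK; ring.
have /existsP[j wj] : [exists j, w j 0 != 0].
  apply: contraT => /existsPn h; case/negP: w0; apply/eqP/matrixP => a b.
  by rewrite mxE ord1; apply/eqP/negPn/h.
rewrite (bigD1 j)//= ltr_wpDr ?sumr_ge0// => [i _|].
  by rewrite mulr_ge0 ?exprn_ge0// ler0c ltW.
by rewrite mulr_gt0 ?exprn_gt0 ?normr_gt0// ltcR.
Qed.

(** * The cell-free uplink *)

Section CellFreeInterference.
Local Open Scope sesquilinear_scope.
Context (R : realType) (d : measure_display) (T : measurableType d)
  (P : probability T R) (N L K : nat) (M : 'I_K.+1 -> {set 'I_L})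
  (h v : 'I_K.+1 -> 'I_L -> T -> 'cV[R[i]]_N) (sigma2 : R).
Hypothesis h_random : forall i l, random_mx (h i l).
Hypothesis v_random : forall k l, l \in M k -> random_mx (v k l).
Hypothesis v_moment : forall k l, l \in M k ->
  (0 < 'E_P[fun w => sqnorm (v k l w)] < +oo)%E.
Hypothesis vh_moment : forall k l i, l \in M k ->
  ('E_P[fun w => (ComplexField.Normc.normc (vh h v k i l w) ^+ 2)%R] < +oo)%E.
Hypothesis sigma2_gt0 : 0 < sigma2.
Hypothesis Eg_neq0 : forall k, Emx P (g M h v k k) != 0.

(** Square integrability makes the expectations of g and g g^H genuine integrals rather than default
    values of [fine]. *)
Lemma g_cLfun2 k i : cLfun_mx P 2%:E (g M h v k i).
Proof.
move=> j b; have jM := enum_valP j.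
have := random_mx_mul (random_mx_adj (v_random jM)) (h_random i (enum_val j)) 0 0.
move=> [mR mI]; under eq_fun do rewrite mxE.
by apply: cLfun2_of_normc => //; exact: vh_moment.
Qed.

(* For [i = k] this is the covariance matrix of [g k k], hence still positive
   semidefinite. *)
Definition interference_mx k i : 'M[R[i]]_#|M k| :=
  Emx P (fun w => g M h v k i w *m (g M h v k i w) ^t*)
  - (i == k)%:R *: (Emx P (g M h v k k) *m (Emx P (g M h v k k)) ^t*).

Lemma Emx_g_adj k :
  Emx P (fun w => (g M h v k k w) ^t*) = (Emx P (g M h v k k)) ^t*.
Proof. by apply: Emx_adj => a b; apply: cLfun2_cLfun1; exact: g_cLfun2. Qed.

(** The subtracted rank-one term is absorbed into the summand i = k, so that every coefficient of
    the affine form is positive semidefinite. *)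
Lemma CmxE k eta : Cmx P M h v sigma2 k eta =
  affine_mx (interference_mx k) (Fmx P M v sigma2 k) eta.
Proof.
rewrite /Cmx /affine_mx Emx_g_adj; congr (_ + _).
under [in RHS]eq_bigr do rewrite scalerBr scalerA.
rewrite sumrB; congr (_ - _).
rewrite (bigD1 k)//= eqxx mulr1 big1 ?addr0// => i ik.
by rewrite (negbTE ik) mulr0 scale0r.
Qed.

Lemma interference_mx_herm k i : (interference_mx k i) ^t* = interference_mx k i.
Proof.
rewrite /interference_mx adjmxD -scaleNr adjmxZ rmorphN /= conjC_nat.
by rewrite Emx_outer_herm ?adjmxM ?trmxCK//; exact: g_cLfun2.
Qed.

Lemma interference_mx_ge0 k i a : 0 <= qform (interference_mx k i) a.
Proof.
rewrite /interference_mx -scaleNr qformD qformZ.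
case: eqVneq => [->|_]; last first.
  by rewrite oppr0 mul0r addr0 qform_Emx_outer_ge0//; exact: g_cLfun2.
by rewrite mulN1r subr_ge0 qform_Emx_outer_ge//; exact: g_cLfun2.
Qed.

Lemma Fmx_posdef k : posdef (Fmx P M v sigma2 k).
Proof.
apply: diag_mx_posdef => j; rewrite mulr_gt0// fine_gt0//.
exact/v_moment/enum_valP.
Qed.

Lemma eta_tildeE eta k : eta_tilde P M h v sigma2 eta k =
  interference (interference_mx k) (Fmx P M v sigma2 k) (Emx P (g M h v k k)) eta.
Proof. by rewrite /eta_tilde /gain CmxE Emx_g_adj. Qed.

Lemma eta_tilde_gt0 eta : (forall k, 0 <= eta k) ->
  forall k, 0 < eta_tilde P M h v sigma2 eta k.
Proof.
move=> eta0 k; rewrite eta_tildeE; apply: interference_gt0 => //.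
- exact: interference_mx_herm.
- exact: interference_mx_ge0.
- exact: Fmx_posdef.
Qed.

Lemma eta_tilde_mono eta eta' : (forall k, 0 <= eta k <= eta' k) ->
  forall k, eta_tilde P M h v sigma2 eta k <= eta_tilde P M h v sigma2 eta' k.
Proof.
move=> le k; rewrite !eta_tildeE; apply: interference_mono => //.
- exact: interference_mx_herm.
- exact: interference_mx_ge0.
- exact: Fmx_posdef.
Qed.

Lemma eta_tilde_superhomog eta (a : R) : (forall k, 0 <= eta k) -> 0 <= a <= 1 ->
  forall k, a * eta_tilde P M h v sigma2 eta k
    + (1 - a) * eta_tilde P M h v sigma2 (fun=> 0) k
    <= eta_tilde P M h v sigma2 (fun i => a * eta i) k.
Proof.
move=> eta0 a01 k; rewrite !eta_tildeE; apply: interference_superhomog => //.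
- exact: interference_mx_herm.
- exact: interference_mx_ge0.
- exact: Fmx_posdef.
Qed.

(** Identifies the SINR with the ratio x / T x of the abstract iteration. *)
Lemma sinrE eta k :
  sinr P M h v sigma2 k eta = eta k / eta_tilde P M h v sigma2 eta k.
Proof. by rewrite /eta_tilde div1r invrK. Qed.

End CellFreeInterference.

(** The optimum is chosen before the starting powers, so every positive start leads to the same
    limit; convergence is stated user by user. *)
Theorem lemma2 (R : realType) (d : measure_display) (T : measurableType d)
    (P : probability T R) (N L K tau : nat)
    (Rcov : 'I_K.+1 -> 'I_L -> 'M[R[i]]_N)
    (h : 'I_K.+1 -> 'I_L -> T -> 'cV[R[i]]_N)
    (phi : 'I_K.+1 -> 'rV[R[i]]_tau)
    (Z : 'I_L -> T -> 'M[R[i]]_(N, tau))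
    (hhat : 'I_K.+1 -> 'I_L -> T -> 'cV[R[i]]_N)
    (M : 'I_K.+1 -> {set 'I_L})
    (v : 'I_K.+1 -> 'I_L -> T -> 'cV[R[i]]_N)
    (sigma2 rho : R)
    (h_gaussian : forall i l, complex_gaussian P (h i l) (Rcov i l))
    (Z_random : forall l, random_mx (Z l))
    (hZ_indep : mutually_independent P (channel_noise_sigma h Z))
    (hhat_random : forall i l, random_mx (hhat i l))
    (hhat_estimate : forall i l,
       exists f : 'M[R[i]]_(N, tau) -> 'cV[R[i]]_N,
       forall w, hhat i l w = f (pilot_obs phi (fun i' => h i' l) (Z l) w))
    (M_nonempty : forall k, M k != finset.set0)
    (v_random : forall k l, l \in M k -> random_mx (v k l))
    (v_local : forall k l, l \in M k ->
       exists f : ('I_K.+1 -> 'cV[R[i]]_N) -> 'cV[R[i]]_N,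
       forall w, v k l w = f (fun i => hhat i l w))
    (v_moment : forall k l, l \in M k ->
       (0 < 'E_P[fun w => sqnorm (v k l w)] < +oo)%E)
    (vh_moment : forall k l i, l \in M k ->
       ('E_P[fun w => (ComplexField.Normc.normc (vh h v k i l w) ^+ 2)%R] < +oo)%E)
    (sigma2_gt0 : 0 < sigma2) (rho_gt0 : 0 < rho)
    (Eg_neq0 : forall k, Emx P (g M h v k k) != 0) :
  exists eta_opt : 'I_K.+1 -> R,
    maxmin_optimal P M h v sigma2 rho eta_opt /\
    forall eta0 : 'I_K.+1 -> R, (forall k, 0 < eta0 k) ->
    forall k,
      (fun j => power_iter P M h v sigma2 rho eta0 j k) @ \oo --> eta_opt k.
Proof.
have h_random i l : random_mx (h i l) by case: (h_gaussian i l).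
(* With [eta_tilde] as the map, [normalized_step] unfolds to [power_step]. *)
have [eta [t [eta_r eta_t eta_opt eta_cvg]]] := normalized_iteration_maxmin rho_gt0
  (eta_tilde_gt0 h_random v_random v_moment vh_moment sigma2_gt0 Eg_neq0)
  (eta_tilde_mono h_random v_random v_moment vh_moment sigma2_gt0 Eg_neq0)
  (eta_tilde_superhomog h_random v_random v_moment vh_moment sigma2_gt0 Eg_neq0).
exists eta; split; last by move=> eta0 eta00 k; apply: eta_cvg => i; exact: ltW.
split; first exact: eta_r.
move=> eta' /eta_opt[k le_t].
(* All SINRs of the limit equal [t], including the one that seeds the minimum. *)
have -> : min_sinr P M h v sigma2 eta = t.
  rewrite /min_sinr; elim/big_ind: _ => [|x y -> ->|i _]; rewrite ?sinrE//.
  by rewrite minxx.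
by apply: le_trans le_t; rewrite -sinrE; exact: bigmin_le.
Qed.
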